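(* For each integer $p\geq 2$, there exists a positive constant $c_p$ such that ${\rm ex}(n, L_3(\theta_{3,p}))\leq c_p n^{7/5}$ for all $n$.
   Context: $\theta_{3,p}$ is the graph consisting of $p$ internally vertex-disjoint paths of length $3$ joining a pair of vertices; it is bipartite and symmetric between its two parts. For a bipartite graph $H$ with an ordered pair $(A,B)$ of parts and an integer $t\ge 2$, $L_t(H)$ is obtained from $H$ by adding a new vertex $u$ and joining $u$ to every vertex of $A$ by internally disjoint paths of length $t-1$ whose internal vertices are new (disjoint from $V(H)$). ${\rm ex}(n,H)$ is the maximum number of edges in an $n$-vertex graph containing no copy of $H$. *)

(* Defs.v *)
From HB Require Import structures.
From mathcomp Require Import all_boot.

Set Implicit Arguments.
Unset Strict Implicit.
Unset Printing Implicit Defensive.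

Local Open Scope nat_scope.

Record graph (V : finType) := Graph {
  edges :> {set {set V}};
  edges_card2 : [forall e in edges, #|e| == 2]
}.

HB.instance Definition _ (V : finType) := [isSub for @edges V].
HB.instance Definition _ (V : finType) := [Finite of graph V by <:].

(* H occurs in G as a (not necessarily induced) subgraph. *)
Definition contains (W V : finType) (G : graph W) (H : graph V) : bool :=
  [exists f : {ffun V -> W},
     injectiveb f && [forall e in edges H, f @: e \in edges G]].

Definition ex (V : finType) (n : nat) (H : graph V) : nat :=
  \max_(G : graph 'I_n | ~~ contains G H) #|edges G|.

Record bigraph (V : finType) := Bigraph {
  bigraph_graph :> graph V;
  partA : {set V};
  partB : {set V};
  parts_cover : partA :|: partB = [set: V];
  parts_disjoint : [disjoint partA & partB];
  parts_edges : forall e, e \in edges bigraph_graph ->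
    exists2 a, a \in partA & exists2 b, b \in partB & e = [set a; b]
}.

Section Theta.
Variable p : nat.

(* inl false and inl true are the two joined vertices; inr (i, b) is the
   internal vertex of the i-th path that is adjacent to inl b. *)
Definition theta3_vertex : finType := (bool + 'I_p * bool)%type.

Definition theta3_end (b : bool) : theta3_vertex := inl b.
Definition theta3_inner (i : 'I_p) (b : bool) : theta3_vertex := inr (i, b).

Definition theta3_edges : {set {set theta3_vertex}} :=
  \bigcup_(i < p)
    [set [set theta3_end false; theta3_inner i false];
         [set theta3_inner i false; theta3_inner i true];
         [set theta3_inner i true; theta3_end true]].

Definition theta3_partA : {set theta3_vertex} :=
  theta3_end false |: [set theta3_inner i true | i : 'I_p].
Definition theta3_partB : {set theta3_vertex} :=
  theta3_end true |: [set theta3_inner i false | i : 'I_p].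

Lemma theta3_edges_card2 : [forall e in theta3_edges, #|e| == 2].
Proof.
apply/forall_inP => e /bigcupP[i _].
rewrite !inE => /orP[/orP[]|] /eqP->; rewrite cards2 //.
by rewrite (inj_eq inr_inj) xpair_eqE andbF.
Qed.

Lemma theta3_inner_partA i : theta3_inner i true \in theta3_partA.
Proof. by rewrite inE; apply/orP; right; apply/imsetP; exists i. Qed.

Lemma theta3_inner_partB i : theta3_inner i false \in theta3_partB.
Proof. by rewrite inE; apply/orP; right; apply/imsetP; exists i. Qed.

Lemma theta3_parts_cover : theta3_partA :|: theta3_partB = [set: theta3_vertex].
Proof.
apply/setP => -[[]|[i []]]; rewrite in_setT in_setU.
- by rewrite setU11 orbT.
- by rewrite setU11.
- by rewrite theta3_inner_partA.
- by rewrite theta3_inner_partB orbT.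
Qed.

Lemma theta3_parts_disjoint : [disjoint theta3_partA & theta3_partB].
Proof.
apply/pred0P => x /=; apply/negP; rewrite !inE.
by move=> /andP[/orP[/eqP->|/imsetP[i _ ->]] /orP[/eqP //|/imsetP[j _ //]]].
Qed.

Lemma theta3_parts_edges e : e \in theta3_edges ->
  exists2 a, a \in theta3_partA & exists2 b, b \in theta3_partB & e = [set a; b].
Proof.
have inA := theta3_inner_partA; have inB := theta3_inner_partB.
move=> /bigcupP[i _]; rewrite !inE => /orP[/orP[]|] /eqP->.
- by exists (theta3_end false); [rewrite setU11 | exists (theta3_inner i false)].
- by exists (theta3_inner i true) => //; exists (theta3_inner i false);
    rewrite // setUC.
- by exists (theta3_inner i true) => //; exists (theta3_end true);
    rewrite ?setU11.
Qed.

(* The choice of the ordered pair of parts is immaterial: (i, b) |-> (i, ~~ b),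
   b |-> ~~ b is an automorphism exchanging them. *)
Definition theta3 : bigraph theta3_vertex :=
  @Bigraph _ (Graph theta3_edges_card2) theta3_partA theta3_partB
    theta3_parts_cover theta3_parts_disjoint theta3_parts_edges.

End Theta.

Section Extension.
Variables (V : finType) (t : nat) (H : bigraph V).

(* inl x is the vertex x of H, inr None is the new vertex u, and
   inr (Some (a, j)) is the (j+1)-st vertex after u on the path from u to a. *)
Definition L_vertex : finType :=
  (V + option ({a : V | a \in partA H} * 'I_(t - 2)))%type.

(* For 2 <= t, L_path a 0, ..., L_path a t.-1 are the successive vertices of the
   path of length t.-1 from u to a. *)
Definition L_path (a : {a : V | a \in partA H}) (k : nat) : L_vertex :=
  if k is j.+1 then
    if insub j is Some i then inr (Some (a, i)) else inl (val a)
  else inr None.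

Definition L_edges : {set {set L_vertex}} :=
  [set inl @: (e : {set V}) | e in edges H] :|:
  \bigcup_(a : {a : V | a \in partA H})
    [set [set L_path a k; L_path a k.+1] | k : 'I_(t.-1)].

Lemma L_edges_card2 : [forall e in L_edges, #|e| == 2].
Proof.
apply/forall_inP => e; rewrite inE => /orP[/imsetP[e' e'H ->]|].
  by rewrite card_imset; [exact: (forall_inP (edges_card2 H)) | exact: inl_inj].
move=> /bigcupP[a _ /imsetP[[k kt] _ ->]] /=; rewrite cards2.
case: k kt => [|k] kt /=; first by case: insub.
have kt2 : k < t - 2 by case: t kt => [|[|t']] //; rewrite !subSS subn0.
rewrite (insubT (fun j => j < t - 2) kt2).
case: insubP => [j _ jE|//].
rewrite (inj_eq inr_inj) (inj_eq Some_inj) xpair_eqE eqxx /=.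
by rewrite -val_eqE /= jE neq_ltn ltnSn.
Qed.

Definition L : graph L_vertex := Graph L_edges_card2.

End Extension.

Arguments L {V} t H.

(* Main.v *)
(** Let G be an L_3(theta_{3,p})-free graph on m vertices, almost regular of degree
    about d.  Call a pair of vertices heavy if it has at least q common neighbours.
    Among the 2-walks from any vertex u, only a small fraction have heavy endpoints,
    since otherwise one builds L_3(theta_{3,p}) greedily inside the heavy pairs.
    Hence about d^3 walks u s w y have both (u, w) and (s, y) light.  Choosing for
    each w one parent s gives a bipartite graph B of about d^3 edges between the at
    most O(d^2) vertices w and the vertices y, in which every y has fewer than q
    neighbours w with a given parent.  A theta_{3,p} in B whose A-vertices have
    distinct parents, together with u and these parents, is an L_3(theta_{3,p}).
    Counting paths x v w y in B, of which there are at least a constant times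
    e(B)^3 / (d^2 m), shows that one exists unless d^5 = O(m^2).

    For an arbitrary graph, take a smallest vertex set S violating
    e(S)^5 <= C |S|^7.  By minimality few edges of S meet the vertices of large
    degree; deleting these and then the vertices of small degree leaves an almost
    regular subgraph, to which the bound d^5 = O(m^2) applies. *)

Require Import Defs.
From mathcomp Require Import all_boot all_order all_algebra.
From mathcomp Require Import all_classical all_reals all_analysis.
From mathcomp Require Import fintype finset zify.

Set Implicit Arguments.
Unset Strict Implicit.
Unset Printing Implicit Defensive.

Local Open Scope nat_scope.

(** * Greedy choice *)

(** Elements are picked one index at a time: each earlier pick excludes at most [M] elements of
    [A i], so fewer than [#|A i|] are excluded in total. *)
Lemma greedy_independent (I Z : finType) (z0 : Z) (conf : rel Z)
    (A : I -> {set Z}) (M : nat) :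
    symmetric conf ->
    (forall i z, #|[set a in A i | conf z a]| <= M) ->
    (forall i, M * #|I| < #|A i|) ->
  exists f : I -> Z, (forall i, f i \in A i) /\
    (forall i j, i != j -> ~~ conf (f i) (f j)).
Proof.
move=> confC confM AM.
suff [f [fA fc]] : exists f : I -> Z, (forall i, i \in enum I -> f i \in A i) /\
    {in enum I &, forall i j, i != j -> ~~ conf (f i) (f j)}.
  exists f; split=> [i|i j]; first by apply: fA; rewrite mem_enum.
  by apply: fc; rewrite mem_enum.
have: uniq (enum I) by exact: enum_uniq.
elim: (enum I) => [|i s IH] /=; first by exists (fun=> z0).
move=> /andP[_ us]; have [f [fA fc]] := IH us.
have [a aA ac] : exists2 a, a \in A i & forall j, j \in s -> ~~ conf (f j) a.
  pose bad := \bigcup_(j in s) [set a in A i | conf (f j) a].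
  have badM : #|bad| <= M * #|I|.
    apply: leq_trans (_ : \sum_(j in s) M <= _).
      rewrite /bad; apply: (big_ind2 (fun (X : {set Z}) n => #|X| <= n)).
      - by rewrite cards0.
      - by move=> X m Y n Xm Yn; rewrite cardsU; lia.
      - by move=> j _; exact: confM.
    by rewrite sum_nat_const mulnC leq_mul2l max_card orbT.
  have : 0 < #|A i :\: bad|.
    have := cardsID bad (A i); have := AM i.
    by have := subset_leq_card (subsetIr (A i) bad); lia.
  case/card_gt0P => a; rewrite inE => /andP[abad aA]; exists a => // j js.
  apply: contra abad => jc; apply/bigcupP; exists j => //.
  by rewrite inE aA.
exists (fun j => if j == i then a else f j); split.
  move=> j; rewrite inE; case: eqP => [->//|_] /= js; exact: fA.
move=> j k; rewrite !inE.
case: (eqVneq j i) => [->|ji] /=; case: (eqVneq k i) => [->|ki] //=.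
- by move=> _ ks _; rewrite confC; apply: ac.
- by move=> js _ _; apply: ac.
- exact: fc.
Qed.

(** * Heavy pairs *)

(* L_3(theta_{3,p}) seen as the path u - s None - x together with p spiders of
   centres w i and legs w i - y, w i - s (Some i) - u, w i - v i - x; thus x, y are
   the ends of theta and A = {x, w i}. *)
Record L_copy (T : finType) (g : rel T) (p : nat) (u x y : T)
    (s : option 'I_p -> T) (v w : 'I_p -> T) : Prop := LCopy {
  Lc_us : forall o, g u (s o);
  Lc_sx : g (s None) x;
  Lc_sw : forall i, g (s (Some i)) (w i);
  Lc_xv : forall i, g x (v i);
  Lc_vw : forall i, g (v i) (w i);
  Lc_wy : forall i, g (w i) y;
  Lc_injs : injective s;
  Lc_injv : injective v;
  Lc_injw : injective w;
  Lc_ux : u != x;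
  Lc_uy : u != y;
  Lc_uv : forall i, u != v i;
  Lc_uw : forall i, u != w i;
  Lc_xy : x != y;
  Lc_sx_neq : forall o, s o != x;
  Lc_sy_neq : forall o, s o != y;
  Lc_sv_neq : forall o i, s o != v i;
  Lc_sw_neq : forall o i, s o != w i;
  Lc_xw_neq : forall i, x != w i;
  Lc_vy_neq : forall i, v i != y;
  Lc_vw_neq : forall i j, v i != w j
}.

Definition L_free (T : finType) (g : rel T) (p : nat) : Prop :=
  forall u x y s v w, ~ @L_copy T g p u x y s v w.

Lemma tuple_of_card (T : finType) (A : {set T}) (p : nat) : p <= #|A| ->
  exists2 f : 'I_p -> T, injective f & forall i, f i \in A.
Proof.
move=> pA; exists (fun i => enum_val (widen_ord pA i)) => [i j|i].
  by move/enum_val_inj/(congr1 val) => /= /val_inj.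
exact: enum_valP.
Qed.

Lemma card_codom_le (T : finType) (p : nat) (f : 'I_p -> T) :
  #|[set f i | i : 'I_p]| <= p.
Proof. by apply: leq_trans (leq_imset_card _ _) _; rewrite card_ord. Qed.

Lemma card_setD_ge (T : finType) (A B : {set T}) : #|A| - #|B| <= #|A :\: B|.
Proof.
have := cardsID B A; have := subset_leq_card (subsetIr A B); lia.
Qed.

Lemma distinct_representatives (I T : finType) (t0 : T) (A : I -> {set T}) :
    (forall i, #|I| < #|A i|) ->
  exists2 f : I -> T, (forall i, f i \in A i) & injective f.
Proof.
move=> AI; have [|i z|i|f [fA finj]] :=
    @greedy_independent I T t0 (fun a b => a == b) A 1.
- by move=> a b; rewrite eq_sym.
- rewrite -(cards1 z); apply: subset_leq_card; apply/subsetP => a.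
  by rewrite !inE eq_sym => /andP[].
- by rewrite mul1n.
exists f => // i j fij; apply/eqP; apply: contraT => /finj.
by rewrite fij eqxx.
Qed.

Section HeavyPairs.
Variables (T : finType) (g : rel T) (p : nat).
Hypotheses (gC : symmetric g) (gI : irreflexive g) (Lfree : L_free g p).

Definition nbr (a : T) : {set T} := [set b | g a b].
Definition codeg (a b : T) : nat := #|nbr a :&: nbr b|.
Definition heavy (q : nat) (u : T) : {set T} :=
  [set w | (w != u) && (q <= codeg u w)].

Lemma in_nbr a b : (b \in nbr a) = g a b. Proof. by rewrite inE. Qed.

Lemma g_neq a b : g a b -> a != b.
Proof. by move=> gab; apply: contraTneq gab => ->; rewrite gI. Qed.

(* Otherwise p such vertices v i, with x := w, extend greedily to a copy: the w i are
   common neighbours of v i and y, and heaviness of w i supplies the s (Some i). *)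
Lemma few_rich_neighbours q u y w :
    3 * p + 4 <= q -> y != u -> g y w -> w \in heavy q u ->
  #|[set v in nbr w | [&& v != y, v != u &
      2 * p + 2 <= #|nbr v :&: nbr y :&: heavy q u|]]| < p.
Proof.
move=> pq yu gyw wH; rewrite ltnNge; apply/negP => /tuple_of_card[v vinj vA].
have {vA} vP i : [/\ g w (v i), v i != y, v i != u &
    2 * p + 2 <= #|nbr (v i) :&: nbr y :&: heavy q u|].
  by have := vA i; rewrite 2!inE => /andP[? /and3P[? ? ?]]; split.
pose Fw : {set T} := w |: [set v i | i : 'I_p].
have Fwp : #|Fw| <= p.+1.
  by rewrite cardsU1; have := card_codom_le v; case: (_ \notin _); lia.
(* Removing [Fw] from at least [2 * p + 2] candidates leaves more than [p], enough for distinct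
   [f i] that avoid [w] and every [v j]. *)
have [i|f fA finj] := @distinct_representatives 'I_p T u
    (fun i => (nbr (v i) :&: nbr y :&: heavy q u) :\: Fw).
  rewrite card_ord; have [_ _ _ ?] := vP i.
  by apply: leq_trans (card_setD_ge _ _); lia.
have {fA} fP i : [/\ g (v i) (f i), g y (f i), f i \in heavy q u,
    f i != w & forall j, v j != f i].
  have := fA i; rewrite 2!inE negb_or => /andP[/andP[fw fv]].
  rewrite 2!inE !in_nbr => /andP[/andP[? ?] ?]; split => //; first by rewrite inE in fw.
  move=> j; apply: contra fv => /eqP<-; apply/imsetP; by exists j.
pose a (o : option 'I_p) := if o is Some i then f i else w.
have aH o : a o \in heavy q u by case: o => [i|] //=; case: (fP i).
(* The bound [3 * p + 4] on [q] is made of [2 * p + 2] excluded vertices plus [p + 2], one more than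
   the number of vertices [s o]. *)
pose Fs : {set T} := y |: (w |: ([set v i | i : 'I_p] :|: [set f i | i : 'I_p])).
have Fsp : #|Fs| <= 2 * p + 2.
  have := card_codom_le v; have := card_codom_le f.
  by rewrite /Fs !cardsU1 cardsU; do 2![case: (_ \notin _)]; lia.
have [i|s sA sinj] := @distinct_representatives (option 'I_p) T u
    (fun o => (nbr u :&: nbr (a o)) :\: Fs).
  rewrite card_option card_ord; have := aH i; rewrite inE => /andP[_].
  by rewrite /codeg => ?; apply: leq_trans (card_setD_ge _ _); lia.
have {sA} sP o : [/\ g u (s o), g (a o) (s o), s o != y, s o != w &
   forall i, s o != v i /\ s o != f i].
  have := sA o; rewrite inE [X in _ && X]inE !in_nbr => /andP[sF /andP[? ?]].
  move: sF; rewrite !inE !negb_or => /and4P[? ? sv sf]; split => // i; split.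
    by apply: contra sv => /eqP->; apply/imsetP; exists i.
  by apply: contra sf => /eqP->; apply/imsetP; exists i.
have neqH z : z \in heavy q u -> u != z by rewrite inE eq_sym => /andP[].
apply: (Lfree (u := u) (x := w) (y := y) (s := s) (v := v) (w := f)); split => //.
- by move=> o; case: (sP o).
- by rewrite gC; case: (sP None).
- by move=> i; rewrite gC; case: (sP (Some i)).
- by move=> i; case: (vP i).
- by move=> i; case: (fP i).
- by move=> i; rewrite gC; case: (fP i).
- exact: neqH.
- by rewrite eq_sym.
- by move=> i; rewrite eq_sym; case: (vP i).
- by move=> i; apply: neqH; case: (fP i).
- by rewrite eq_sym g_neq.
- by move=> o; case: (sP o).
- by move=> o; case: (sP o).
- by move=> o i; case: (sP o) => _ _ _ _ /(_ i)[].
- by move=> o i; case: (sP o) => _ _ _ _ /(_ i)[].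
- by move=> i; rewrite eq_sym; case: (fP i).
- by move=> i; case: (vP i).
- by move=> i j; case: (fP j).
Qed.

Definition heavy_walks q u := \sum_(w in heavy q u) codeg u w.

(* Double count the triples (s, w, s') with w heavy and s, s' common neighbours of u
   and w: the codegree inside [heavy q u] of a typical pair s, s' is bounded. *)
Lemma heavy_walks_le q u : 3 * p + 4 <= q ->
  (q - p) * heavy_walks q u <= (2 * p + 2) * #|nbr u| ^ 2.
Proof.
move=> pq; set H := heavy q u; set b := 2 * p + 2.
pose poor s s' := #|nbr s' :&: nbr s :&: H| < b.
(* By [few_rich_neighbours] with [s] as [y], fewer than [p] common neighbours other than [s] fail to
   be poor with [s]; counting [s] itself gives at most [p]. *)
have step w s : w \in H -> s \in nbr u :&: nbr w ->
    codeg u w <= p + #|[set s' in nbr u :&: nbr w | poor s s']|.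
  move=> wH; rewrite inE !in_nbr => /andP[gus gws].
  have su : s != u by rewrite eq_sym g_neq.
  have gsw : g s w by rewrite gC.
  have := few_rich_neighbours pq su gsw wH; set R := [set v in nbr w | _] => Rp.
  have : nbr u :&: nbr w \subset
      s |: R :|: [set s' in nbr u :&: nbr w | poor s s'].
    apply/subsetP => s'; rewrite inE !in_nbr => /andP[gus' gws'].
    rewrite !inE gus' gws' /poor /=; case: eqP => //= _.
    by rewrite (eq_sym s') g_neq //= ltnNge -/H -/b orbN.
  move/subset_leq_card; rewrite /codeg cardsU cardsU1.
  by case: (_ \notin _); lia.
have lower : q * heavy_walks q u <= \sum_(w in H) \sum_(s in nbr u :&: nbr w) codeg u w.
  rewrite big_distrr; apply: leq_sum => w; rewrite inE => /andP[_ qw].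
  by rewrite sum_nat_const leq_mul2r qw orbT.
(* A poor pair [s], [s'] is joined through fewer than [b] heavy [w], so exchanging sums bounds the
   poor triples by [b] per pair of neighbours of [u]. *)
have upper : \sum_(w in H) \sum_(s in nbr u :&: nbr w) codeg u w <=
    p * heavy_walks q u + b * #|nbr u| ^ 2.
  apply: leq_trans (_ : \sum_(w in H) \sum_(s in nbr u :&: nbr w)
     (p + #|[set s' in nbr u :&: nbr w | poor s s']|) <= _).
    by apply: leq_sum => w wH; apply: leq_sum => s; apply: step.
  under eq_bigr => w _ do rewrite big_split /= sum_nat_const mulnC.
  rewrite big_split /= -big_distrr leq_add2l.
  under eq_bigr => w _ do under eq_bigr => s _ do rewrite -sum1_card.
  apply: leq_trans (_ : \sum_(s in nbr u) \sum_(s' in nbr u) b <= _); last first.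
    by rewrite !sum_nat_const mulnA [X in _ <= X]mulnC -mulnn.
  under eq_bigr => w _ do under eq_bigl => s do rewrite inE.
  under eq_bigr => w _ do rewrite big_mkcondr.
  rewrite exchange_big; apply: leq_sum => s _.
  apply: leq_trans (_ : \sum_(w in H) \sum_(s' in nbr u)
      (if (w \in nbr s') && (w \in nbr s) && poor s s' then 1 else 0) <= _).
    apply: leq_sum => w _; case: ifP => // sw.
    rewrite big_mkcond [X in _ <= X]big_mkcond; apply: leq_sum => s' _.
    by rewrite !inE in sw *; rewrite (gC s') (gC s) sw; case: (g u s'); case: (g w s').
  rewrite exchange_big; apply: leq_sum => s' _.
  case: (boolP (poor s s')) => pss; last first.
    by rewrite big1 // => w _; rewrite andbF.
  apply: leq_trans (ltnW pss); rewrite -sum1_card -big_mkcondr.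
  rewrite [X in X <= _]big_mkcond [X in _ <= X]big_mkcond; apply: leq_sum => w _.
  rewrite andbT [w \in _ :&: _]inE [w \in _ :&: _]inE andbC.
  by case: (_ && (w \in H)).
rewrite mulnBl; lia.
Qed.
End HeavyPairs.

(** * Coloured bipartite graphs *)

Lemma card_le_fibres (Z E : finType) (f : Z -> E) (Q : {set Z}) (S : {set E}) M :
    (forall z, z \in Q -> f z \in S) ->
    (forall e, e \in S -> #|[set z in Q | f z == e]| <= M) ->
  #|Q| <= #|S| * M.
Proof.
move=> QS SM; rewrite -sum1_card (partition_big f (mem S)) //= -sum_nat_const.
apply: leq_sum => e eS; apply: leq_trans (SM e eS).
by rewrite -sum1_card; apply: eq_leq; apply: eq_bigl => z; rewrite inE.
Qed.

Lemma card_le_param (Z E : finType) (h : E -> Z) (A : {set Z}) (B : {set E}) :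
  (forall z, z \in A -> exists2 e, e \in B & z = h e) -> #|A| <= #|B|.
Proof.
move=> AB; apply: leq_trans (leq_imset_card h _); apply: subset_leq_card.
by apply/subsetP => z /AB[e eB ->]; apply: imset_f.
Qed.

Section ColouredBipartite.
(** [B x y] joins a left vertex [x] of colour [c x] to a right vertex [y]. Both sides live in [T]
    and may overlap, hence the inequalities between left and right vertices in [no_theta]. *)
Variables (T : finType) (B : rel T) (c : T -> T) (p q d : nat) (W : {set T}).
Let X y : {set T} := [set x | B x y].
Let Y x : {set T} := [set y | B x y].
Let Bs : {set T * T} := [set e | B e.1 e.2].
Hypothesis BI : forall x, ~~ B x x.
Hypothesis BW : forall x y, B x y -> x \in W.
Hypothesis Bq : forall y z, #|[set x in X y | c x == z]| <= q.
Hypothesis Xd : forall y, #|X y| <= d.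
Hypothesis Yd : forall x, #|Y x| <= d.
Hypothesis no_theta : forall x y (v w : 'I_p -> T),
  (forall i, [/\ B x (v i), B (w i) (v i) & B (w i) y]) -> injective v ->
  injective (c \o w) -> x != y ->
  (forall i, c (w i) != c x) -> (forall i, v i != y) ->
  (forall i j, v i != w j) -> False.

(** Threshold for a rich pair: after excluding [q + p] left vertices more than [q * p] remain, and
    after excluding [p + 1] right vertices more than [p] remain. *)
Let r := q * p.+1 + p.*2 + 2.

Lemma Bneq x y : B x y -> x != y.
Proof. by move=> Bxy; apply: contraTneq Bxy => ->; rewrite (negbTE (BI _)). Qed.

Lemma coloured_representatives (A : 'I_p -> {set T}) (t0 : T) :
    (forall i z, #|[set x in A i | c x == z]| <= q) ->
    (forall i, q * p < #|A i|) ->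
  exists f : 'I_p -> T, (forall i, f i \in A i) /\ injective (c \o f).
Proof.
move=> Aq Ap; have [|i z|i|f [fA finj]] :=
    @greedy_independent 'I_p T t0 (fun a b => c a == c b) A q.
- by move=> a b; rewrite eq_sym.
- by under eq_finset => a do rewrite (eq_sym (c z)).
- by rewrite card_ord.
exists f; split=> // i j /= fij; apply/eqP; apply: contraT => /finj.
by rewrite fij eqxx.
Qed.

(** Any [p] such [v] would be the [v i] of a theta with ends [w] and [y]: the many common neighbours
    of [v i] and [y] allow [w i] of distinct colours, none that of [w]. *)
Lemma few_heavy_right w y : B w y ->
  #|[set v in Y w | (v != y) && (r <= #|X v :&: X y|)]| <= p.
Proof.
move=> Bwy; apply: ltnW; rewrite ltnNge; apply/negP => /tuple_of_card[v vinj vA].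
have {vA} vP i : [/\ B w (v i), v i != y & r <= #|X (v i) :&: X y|].
  by have := vA i; rewrite 2!inE => /andP[? /andP[]].
pose F : {set T} := [set x in X y | c x == c w] :|: [set v i | i : 'I_p].
have Fp : #|F| <= q + p.
  by rewrite cardsU; have := Bq y (c w); have := card_codom_le v; lia.
have [i z|i|f [fA finj]] :=
  coloured_representatives (A := fun i => (X (v i) :&: X y) :\: F) y.
- apply: leq_trans (Bq y z); apply: subset_leq_card; apply/subsetP => x.
  by rewrite !inE => /andP[/andP[_ /andP[_ ->]] ->].
- have [_ _ ri] := vP i; apply: leq_trans (card_setD_ge _ _).
  by move: ri; rewrite /r mulnS; lia.
have {fA} fP i : [/\ B (f i) (v i), B (f i) y, c (f i) != c w & forall j, v j != f i].
  have := fA i; rewrite !inE negb_or => /andP[/andP[fc fv] /andP[fvi fy]].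
  rewrite fy in fc; split=> // j; apply: contra fv => /eqP<-.
  by apply/imsetP; exists j.
apply: (no_theta (x := w) (y := y) (v := v) (w := f)) => // [i||i|i|i j].
- by have [? _ _] := vP i; have [? ? _ _] := fP i; split.
- exact: Bneq.
- by case: (fP i).
- by case: (vP i).
- by case: (fP j).
Qed.

(** Among more than [q * p] such [w], some [p] have distinct colours; distinct common neighbours
    with [x] then complete a theta with ends [x] and [v]. *)
Lemma few_heavy_left x v : B x v ->
  #|[set w in X v | (c w != c x) && (r <= #|Y x :&: Y w|)]| <= q * p.
Proof.
move=> Bxv; rewrite leqNgt; apply/negP; set A := [set w in _ | _] => Ap.
have [i z|i|f [fA finj]] := coloured_representatives (A := fun=> A) v.
- apply: leq_trans (Bq v z); apply: subset_leq_card; apply/subsetP => w.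
  by rewrite !inE => /andP[/andP[-> _] ->].
- exact: Ap.
have {fA} fP i : [/\ B (f i) v, c (f i) != c x & r <= #|Y x :&: Y (f i)|].
  by have := fA i; rewrite 2!inE => /andP[? /andP[? ?]]; split.
pose F : {set T} := v |: [set f i | i : 'I_p].
have Fp : #|F| <= p.+1.
  by rewrite cardsU1; have := card_codom_le f; case: (_ \notin _); lia.
have [i|h hA hinj] := @distinct_representatives 'I_p T v
    (fun i => (Y x :&: Y (f i)) :\: F).
  rewrite card_ord; have [_ _ ri] := fP i; apply: leq_trans (card_setD_ge _ _).
  by move: ri; rewrite /r mulnS; lia.
have {hA} hP i : [/\ B x (h i), B (f i) (h i), h i != v & forall j, h i != f j].
  have := hA i; rewrite !inE negb_or => /andP[/andP[hv hf] /andP[? ?]].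
  split=> // j; apply: contra hf => /eqP->; by apply/imsetP; exists j.
apply: (no_theta (x := x) (y := v) (v := h) (w := f)) => // [i||i|i|i j].
- by have [? _ _] := fP i; have [? ? _ _] := hP i; split.
- exact: Bneq.
- by case: (fP i).
- by case: (hP i).
- by case: (hP i).
Qed.

(** Middle pairs [(v, w)] of the paths x v w y; the last two conditions bound the number of pairs
    with a given first or second entry. *)
Let light_pairs x y : {set T * T} :=
  [set a | [&& B x a.1, B a.2 a.1, B a.2 y, a.1 != y, c a.2 != c x,
     #|X a.1 :&: X y| < r & #|Y x :&: Y a.2| < r]].

(** Otherwise greedy choice gives [p] pairs forming a theta with ends [x] and [y]. A pair conflicts
    with at most [q * r] pairs through the colour of [w], and with at most [r] through each of the
    three coincidences involving a [v]. *)
Lemma card_light_pairs x y : x != y ->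
  #|light_pairs x y| <= (q * r + 3 * r) * p.
Proof.
move=> xy; rewrite leqNgt; apply/negP => big.
pose conf : rel (T * T) := fun a b =>
  [|| a.1 == b.1, c a.2 == c b.2, a.1 == b.2 | a.2 == b.1].
have [||i|f [fA fc]] :=
    @greedy_independent 'I_p (T * T)%type (x, x) conf (fun=> light_pairs x y)
      (q * r + 3 * r).
- move=> a b; rewrite /conf (eq_sym a.1) (eq_sym (c a.2)) (eq_sym a.1) (eq_sym a.2).
  by rewrite [X in _ || (_ || X)]orbC.
- move=> _ [v0 w0]; rewrite /conf /=.
  have byfst z : #|[set a in light_pairs x y | z == a.1]| <= r.
    case: (ltnP #|X z :&: X y| r) => zr; last first.
      rewrite (_ : [set a in _ | _] = set0) ?cards0 //; apply/setP => -[v w].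
      rewrite !inE /=; apply/negP => /andP[/and5P[_ _ _ _ /and3P[_ vr _]] /eqP zv].
      by move: vr; rewrite -zv; lia.
    apply: leq_trans (ltnW zr); apply: (card_le_param (h := fun w => (z, w))).
    move=> [v w]; rewrite !inE /= => /andP[/and5P[_ wv wy _ _] /eqP->].
    by exists w => //; rewrite !inE wv wy.
  have bysnd z : #|[set a in light_pairs x y | z == a.2]| <= r.
    case: (ltnP #|Y x :&: Y z| r) => zr; last first.
      rewrite (_ : [set a in _ | _] = set0) ?cards0 //; apply/setP => -[v w].
      rewrite !inE /=; apply/negP => /andP[/and5P[_ _ _ _ /and3P[_ _ vr]] /eqP zv].
      by move: vr; rewrite -zv; lia.
    apply: leq_trans (ltnW zr); apply: (card_le_param (h := fun v => (v, z))).
    move=> [v w]; rewrite !inE /= => /andP[/and5P[xv wv _ _ _] /eqP->].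
    by exists v => //; rewrite !inE xv wv.
  have bycol z : #|[set a in light_pairs x y | z == c a.2]| <= q * r.
    apply: leq_trans (_ : #|[set w in X y | c w == z]| * r <= _); last first.
      by rewrite leq_mul2r Bq orbT.
    apply: (card_le_fibres (f := snd)) => [[v w]|w].
      by rewrite !inE /= => /andP[/and5P[_ _ -> _ _] /eqP->]; rewrite eqxx.
    move=> _; apply: leq_trans (bysnd w); apply: subset_leq_card.
    by apply/subsetP => a; rewrite !inE (eq_sym w) => /andP[/andP[-> _] ->].
  have : [set a in light_pairs x y | [|| v0 == a.1, c w0 == c a.2, v0 == a.2 | w0 == a.1]]
     \subset [set a in light_pairs x y | v0 == a.1]
       :|: ([set a in light_pairs x y | c w0 == c a.2]
       :|: ([set a in light_pairs x y | v0 == a.2]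
       :|: [set a in light_pairs x y | w0 == a.1])).
    apply/subsetP => a; rewrite inE => /andP[aL H].
    by rewrite !in_setU !(inE, in_set) in aL *; rewrite aL.
  move/subset_leq_card/leq_trans; apply; rewrite !cardsU.
  have := byfst v0; have := byfst w0; have := bysnd v0; have := bycol (c w0).
  lia.
- by rewrite card_ord.
have fP i : f i \in light_pairs x y := fA i.
have fcP i j : i != j -> [/\ (f i).1 != (f j).1, c (f i).2 != c (f j).2,
    (f i).1 != (f j).2 & (f i).2 != (f j).1].
  by move/fc; rewrite /conf !negb_or => /and4P[].
apply: (no_theta (x := x) (y := y) (v := fst \o f) (w := snd \o f)) => //=.
- by move=> i; have := fP i; rewrite inE => /and5P[? ? ? _ _]; split.
- move=> i j /= fij; apply/eqP; apply: contraT => /fcP[].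
  by rewrite fij eqxx.
- move=> i j /= fij; apply/eqP; apply: contraT => /fcP[_].
  by rewrite fij eqxx.
- by move=> i; have := fP i; rewrite inE => /and5P[_ _ _ _ /and3P[]].
- by move=> i; have := fP i; rewrite inE => /and5P[].
- move=> i j; case: (eqVneq i j) => [<-|/fcP[] //].
  by have := fP i; rewrite inE => /and5P[_ /Bneq]; rewrite eq_sym.
Qed.

(** A walk x v w y is stored as [((x, v), (w, y))]; degenerate walks are included. *)
Let paths : {set (T * T) * (T * T)} :=
  [set a | [&& B a.1.1 a.1.2, B a.2.1 a.1.2 & B a.2.1 a.2.2]].

(** Discarding the edges with an end of degree below a quarter of the average on its side loses at
    most half of the edges, and each remaining edge is the middle of at least
    [e ^ 2 / (16 * #|W| * #|T|)] walks. *)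
Lemma card_paths_ge : #|Bs| ^ 3 <= 32 * (#|W| * #|T|) * #|paths|.
Proof.
set e := #|Bs|.
pose E1 := [set a in Bs | #|X a.2| * (4 * #|T|) < e].
pose E2 := [set a in Bs | #|Y a.1| * (4 * #|W|) < e].
have aux (k : nat) (A : {set T}) : #|A| * (4 * k) < e -> 0 < k -> #|A| <= e %/ (4 * k).
  by move=> lt k0; rewrite leq_divRL ?muln_gt0 //; lia.
have E1e : 4 * #|E1| <= e.
  have [T0|T0] := posnP #|T|.
    suff -> : E1 = set0 by rewrite cards0.
    apply/setP => a; have : 0 < #|T| by apply/card_gt0P; exists a.1.
    by rewrite T0.
  apply: leq_trans (_ : 4 * (#|[set: T]| * (e %/ (4 * #|T|))) <= e); last first.
    by rewrite cardsT mulnA mulnC leq_divM.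
  rewrite leq_mul2l /=; apply: (card_le_fibres (f := snd)) => // z _.
  case: (ltnP (#|X z| * (4 * #|T|)) e) => ze; last first.
    rewrite (_ : [set a in _ | _] = set0) ?cards0 //; apply/setP => -[v w].
    rewrite !inE /=; apply/negP => /andP[/andP[_ h] /eqP zv].
    by rewrite zv ltnNge ze in h.
  apply: leq_trans (aux _ _ ze T0); apply: (card_le_param (h := fun w => (w, z))).
  move=> [w v]; rewrite !inE /= => /andP[/andP[Bwv _] /eqP vz].
  by exists w; rewrite ?inE -?vz.
have E2e : 4 * #|E2| <= e.
  have [T0|T0] := posnP #|W|.
    suff -> : E2 = set0 by rewrite cards0.
    apply/setP => -[w v]; rewrite !inE; apply/negP => /andP[/BW wW _].
    by move/cards0_eq: T0 wW => ->; rewrite inE.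
  apply: leq_trans (_ : 4 * (#|W| * (e %/ (4 * #|W|))) <= e); last first.
    by rewrite mulnA mulnC leq_divM.
  rewrite leq_mul2l /=; apply: (card_le_fibres (f := fst)) => [[w v]|z _].
    by rewrite !inE => /andP[/BW].
  case: (ltnP (#|Y z| * (4 * #|W|)) e) => ze; last first.
    rewrite (_ : [set a in _ | _] = set0) ?cards0 //; apply/setP => -[v w].
    rewrite !inE /=; apply/negP => /andP[/andP[_ h] /eqP zv].
    by rewrite zv ltnNge ze in h.
  apply: leq_trans (aux _ _ ze T0); apply: (card_le_param (h := fun w => (z, w))).
  move=> [w v]; rewrite !inE /= => /andP[/andP[Bwv _] /eqP vz].
  by exists v; rewrite ?inE -?vz.
pose E0 := Bs :\: (E1 :|: E2).
have E0e : e <= 2 * #|E0|.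
  by have := card_setD_ge Bs (E1 :|: E2); rewrite -/E0 cardsU -/e; lia.
have pathsE : \sum_(a in E0) #|X a.2| * #|Y a.1| <= #|paths|.
  rewrite -[X in _ <= X]sum1_card (partition_big (fun z => (z.2.1, z.1.2)) (mem Bs)) /=.
    rewrite [X in X <= _]big_mkcond [X in _ <= X]big_mkcond; apply: leq_sum => -[w v] _.
    rewrite !inE /=; case: (boolP (B w v)) => Bwv; rewrite ?andbF //.
    case: ifP => // _; rewrite -cardsX sum1dep_card.
    rewrite -(card_imset (f := fun z : T * T => ((z.1, v), (w, z.2)))); last first.
      by move=> [x1 y1] [x2 y2] [-> ->].
    apply: subset_leq_card; apply/subsetP => a /imsetP[[x y]].
    by rewrite !inE /= => /andP[xv wy] ->; rewrite /= xv wy Bwv eqxx.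
  by move=> [[x v] [w y]]; rewrite !inE /= => /and3P[].
have term a : a \in E0 -> e ^ 2 <= 16 * (#|W| * #|T|) * (#|X a.2| * #|Y a.1|).
  rewrite !inE negb_or !negb_and -!leqNgt => /andP[/andP[h1 h2] aB].
  rewrite aB /= in h1 h2; rewrite -mulnn; apply: leq_trans (leq_mul h1 h2) _.
  by move: #|X _| #|Y _| #|W| #|T| => ? ? ? ?; lia.
have : #|E0| * e ^ 2 <= 16 * (#|W| * #|T|) * #|paths|.
  rewrite -sum_nat_const; apply: leq_trans (_ : 16 * (#|W| * #|T|) *
    (\sum_(a in E0) #|X a.2| * #|Y a.1|) <= _); last by rewrite leq_mul2l pathsE orbT.
  by rewrite big_distrr; apply: leq_sum => a; apply: term.
rewrite (expnS e 2) => /(leq_mul (leqnn 2)) h.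
apply: leq_trans (_ : 2 * #|E0| * e ^ 2 <= _).
  by rewrite leq_mul2r E0e orbT.
rewrite -mulnA; apply: leq_trans h _.
by move: #|paths| #|W| #|T| => ? ? ?; lia.
Qed.

(** A walk is either light, and counted by its pair of ends ([P6]), or has a defect. A defective
    walk is determined by one edge, then a choice that the defect restricts to [1], [q], [p] or
    [q * p] vertices, then one of at most [d] neighbours; this gives the factor
    [2 + q + p + q * p]. *)
Lemma card_paths_le : #|paths| <=
  #|Bs| * (d * (2 + q + p + q * p)) + #|W| * #|T| * ((q * r + 3 * r) * p).
Proof.
pose P1 := [set a in paths | a.1.1 == a.2.2].
pose P2 := [set a in paths | a.1.2 == a.2.2].
pose P3 := [set a in paths | c a.2.1 == c a.1.1].
pose P4 := [set a in paths | (a.1.2 != a.2.2) && (r <= #|X a.1.2 :&: X a.2.2|)].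
pose P5 := [set a in paths | (c a.2.1 != c a.1.1) && (r <= #|Y a.1.1 :&: Y a.2.1|)].
pose P6 := [set a in paths | (a.1.1 != a.2.2) &&
  ((a.1.2, a.2.1) \in light_pairs a.1.1 a.2.2)].
have b1 : #|P1| <= #|Bs| * d.
  apply: (card_le_fibres (f := fun a => (a.2.1, a.1.2))) => [[[x v] [w y]]|[w v] _].
    by rewrite !inE /= => /andP[/and3P[]].
  apply: leq_trans (Xd v); apply: (card_le_param (h := fun x => ((x, v), (w, x)))).
  move=> [[x v'] [w' y]]; rewrite !inE /= xpair_eqE.
  move=> /andP[/andP[/and3P[xv _ _] /eqP xy] /andP[/eqP ww /eqP vv]]; subst.
  by exists y; rewrite ?inE.
have b2 : #|P2| <= #|Bs| * d.
  apply: (card_le_fibres (f := fun a => (a.2.1, a.1.2))) => [[[x v] [w y]]|[w v] _].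
    by rewrite !inE /= => /andP[/and3P[]].
  apply: leq_trans (Xd v); apply: (card_le_param (h := fun x => ((x, v), (w, v)))).
  move=> [[x v'] [w' y]]; rewrite !inE /= xpair_eqE.
  move=> /andP[/andP[/and3P[xv _ _] /eqP xy] /andP[/eqP ww /eqP vv]]; subst.
  by exists x; rewrite ?inE.
have b3 : #|P3| <= #|Bs| * (q * d).
  apply: (card_le_fibres (f := fun a => a.1)) => [[[x v] [w y]]|[x v] _].
    by rewrite !inE /= => /andP[/and3P[]].
  apply: leq_trans (_ : #|[set w in X v | c w == c x]| * d <= _); last first.
    by rewrite leq_mul2r Bq orbT.
  apply: (card_le_fibres (f := fun a => a.2.1)) => [[[x' v'] [w y]]|w _].
    rewrite !inE /= xpair_eqE.
    by move=> /andP[/andP[/and3P[_ wv _] cwx] /andP[/eqP <- /eqP <-]]; rewrite wv.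
  apply: leq_trans (Yd w); apply: (card_le_param (h := fun y => ((x, v), (w, y)))).
  move=> [[x' v'] [w' y]]; rewrite !inE /= xpair_eqE.
  move=> /andP[/andP[/andP[/and3P[_ _ wy] _] /andP[/eqP ? /eqP ?]] /eqP ?]; subst.
  by exists y; rewrite ?inE.
have b4 : #|P4| <= #|Bs| * (p * d).
  apply: (card_le_fibres (f := fun a => a.2)) => [[[x v] [w y]]|[w y]].
    by rewrite !inE /= => /andP[/and3P[]].
  rewrite inE /= => Bwy; apply: leq_trans (_ : #|[set v in Y w | (v != y) &&
      (r <= #|X v :&: X y|)]| * d <= _); last first.
    by rewrite leq_mul2r few_heavy_right ?orbT.
  apply: (card_le_fibres (f := fun a => a.1.2)) => [[[x v] [w' y']]|v _].
    rewrite !inE /= xpair_eqE.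
    by move=> /andP[/andP[/and3P[_ wv _] h] /andP[/eqP <- /eqP <-]]; rewrite wv.
  apply: leq_trans (Xd v); apply: (card_le_param (h := fun x => ((x, v), (w, y)))).
  move=> [[x v'] [w' y']]; rewrite !inE /= xpair_eqE.
  move=> /andP[/andP[/andP[/and3P[xv _ _] _] /andP[/eqP ? /eqP ?]] /eqP ?]; subst.
  by exists x; rewrite ?inE.
have b5 : #|P5| <= #|Bs| * (q * p * d).
  apply: (card_le_fibres (f := fun a => a.1)) => [[[x v] [w y]]|[x v]].
    by rewrite !inE /= => /andP[/and3P[]].
  rewrite inE /= => Bxv; apply: leq_trans (_ : #|[set w in X v | (c w != c x) &&
      (r <= #|Y x :&: Y w|)]| * d <= _); last first.
    by rewrite leq_mul2r few_heavy_left ?orbT.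
  apply: (card_le_fibres (f := fun a => a.2.1)) => [[[x' v'] [w y]]|w _].
    rewrite !inE /= xpair_eqE.
    by move=> /andP[/andP[/and3P[_ wv _] h] /andP[/eqP <- /eqP <-]]; rewrite wv.
  apply: leq_trans (Yd w); apply: (card_le_param (h := fun y => ((x, v), (w, y)))).
  move=> [[x' v'] [w' y]]; rewrite !inE /= xpair_eqE.
  move=> /andP[/andP[/andP[/and3P[_ _ wy] _] /andP[/eqP ? /eqP ?]] /eqP ?]; subst.
  by exists y; rewrite ?inE.
have b6 : #|P6| <= #|W| * #|T| * ((q * r + 3 * r) * p).
  rewrite -cardsT -cardsX.
  apply: (card_le_fibres (f := fun a => (a.1.1, a.2.2))) => [[[x v] [w y]]|[x y] _].
    by rewrite !inE /= => /andP[/and3P[/BW-> _ _]].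
  case: (eqVneq x y) => [xy|xy].
    rewrite (_ : [set a in _ | _] = set0) ?cards0 //; apply/setP => -[[x' v] [w y']].
    rewrite in_set0 2!inE xpair_eqE /=.
    apply/negP => /andP[/andP[_ /andP[xy' _]] /andP[/eqP ? /eqP ?]]; subst.
    by rewrite eqxx in xy'.
  apply: leq_trans (card_light_pairs xy).
  apply: (card_le_param (h := fun a => ((x, a.1), (a.2, y)))) => -[[x' v] [w y']].
  rewrite 2!inE xpair_eqE /=.
  move=> /andP[/andP[_ /andP[xy' vw]] /andP[/eqP ? /eqP ?]]; subst.
  by exists (v, w).
have : paths \subset P1 :|: (P2 :|: (P3 :|: (P4 :|: (P5 :|: P6)))).
  apply/subsetP => -[[x v] [w y]] aP.
  rewrite !inE /=.
  move: aP; rewrite inE /= => /and3P[-> -> ->] /=.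
  case: (eqVneq x y) => //= _; case: (eqVneq v y) => //= _.
  case: (eqVneq (c w) (c x)) => //= _.
  by case: (leqP r #|X v :&: X y|) => //= _; case: (leqP r #|Y x :&: Y w|).
move/subset_leq_card/leq_trans; apply.
rewrite !cardsU !mulnDr; nia.
Qed.

Lemma coloured_bipartite_bound :
  #|Bs| ^ 3 <= 32 * (#|W| * #|T|) *
    (#|Bs| * (d * (2 + q + p + q * p)) + #|W| * #|T| * ((q * r + 3 * r) * p)).
Proof.
apply: leq_trans card_paths_ge _; by rewrite leq_mul2l card_paths_le orbT.
Qed.

End ColouredBipartite.

(** * Almost regular graphs *)

Section AlmostRegular.
Variables (T : finType) (g : rel T) (p K delta : nat).
Hypotheses (gC : symmetric g) (gI : irreflexive g) (Lfree : L_free g p).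
Hypothesis degree_ge : forall v, delta <= #|nbr g v|.
Hypothesis degree_le : forall v, #|nbr g v| <= K * delta.
Local Notation N := (nbr g).
Local Notation D := (K * delta).

Lemma walk_sum u (f : T -> nat) :
  \sum_(s in N u) \sum_(w in N s) f w = \sum_w codeg g u w * f w.
Proof.
under eq_bigr => s _ do rewrite big_mkcond.
rewrite exchange_big; apply: eq_bigr => w _ /=.
rewrite -big_mkcondr sum_nat_const; congr (_ * _).
by apply: eq_card => s; rewrite -topredE /= in_setI !in_nbr (gC s w).
Qed.

Section FixedRoot.
Variables (q : nat) (u : T).
Hypothesis pq : 3 * p + 4 <= q.

(** Leaving out the neighbours of [u] keeps [w] and [y] apart from all parents, which lie in
    [N u]. *)
Let W0 : {set T} := [set w | [&& w != u, codeg g u w < q & w \notin N u]].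
Let Y s w : {set T} := [set y in N w | (codeg g s y < q) && (y \notin N u)].

Let light_walks := \sum_(s in N u) \sum_(w in N s | w \in W0) #|Y s w|.

Lemma walks_le_light :
  \sum_(s in N u) \sum_(w in N s) #|N w| <= light_walks + D * heavy_walks g q u +
    \sum_(s in N u) heavy_walks g q s + D ^ 2 * (1 + 2 * q).
Proof.
(* [F] charges a walk u s w y to a failing condition: [w = u], [w] heavy, [w] adjacent to [u], [y]
   heavy for [s], or [y] adjacent to [u]. The last includes [y = s], and leaves fewer than [q]
   choices of [y] when [w] is light. *)
pose F s w := (w \in W0) * #|Y s w| + (w == u) * D + (w \in heavy g q u) * D
    + ((w \in N u) && (codeg g u w < q)) * D + #|N w :&: heavy g q s| + q.
have step s w : s \in N u -> w \in N s -> #|N w| <= F s w.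
  move=> us sw; have wD := degree_le w; rewrite /F [w \in W0]inE [w \in heavy _ _ _]inE.
  case: (eqVneq w u) => [wu|wu] /=; first by rewrite -wu; lia.
  case: (ltnP (codeg g u w) q) => [cw|cw] /=; last by lia.
  case: (boolP (w \in N u)) => wN /=; first by lia.
  have : N w \subset Y s w :|: (N w :&: heavy g q s :|: N u :&: N w).
    apply/subsetP => y wy; rewrite !in_setU !in_setI [y \in Y _ _]inE wy /=.
    case: (boolP (y \in N u)) => yN /=; first by rewrite !orbT.
    rewrite inE andbT orbF; case: ltnP => //= _; rewrite andbT.
    by apply: contraNneq yN => ->.
  by move/subset_leq_card; rewrite !cardsU -/(codeg g u w); lia.
apply: leq_trans (_ : \sum_(s in N u) \sum_(w in N s) F s w <= _).
  by apply: leq_sum => s us; apply: leq_sum => w sw; exact: step.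
under eq_bigr => s _ do rewrite !big_split /=.
rewrite !big_split /= !walk_sum.
have h0 : \sum_(s in N u) \sum_(w in N s) (w \in W0) * #|Y s w| = light_walks.
  apply: eq_bigr => s _; rewrite [RHS]big_mkcondr; apply: eq_bigr => w _.
  by case: (w \in W0); rewrite ?mul1n.
have h1 : \sum_w codeg g u w * ((w == u) * D) <= D ^ 2.
  rewrite (bigD1 u) //= big1 ?addn0 => [|w /negPf->]; last by rewrite mul0n muln0.
  rewrite eqxx mul1n -mulnn leq_mul2r; apply/orP; right.
  by rewrite /codeg setIid.
have h2 : \sum_w codeg g u w * ((w \in heavy g q u) * D) = D * heavy_walks g q u.
  rewrite /heavy_walks big_distrr [RHS]big_mkcond; apply: eq_bigr => w _ /=.
  by case: (w \in heavy g q u); rewrite ?mul1n ?mul0n ?muln0 // mulnC.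
have h3 : \sum_w codeg g u w * (((w \in N u) && (codeg g u w < q)) * D) <= D ^ 2 * q.
  apply: leq_trans (_ : \sum_(w in N u) q * D <= _).
    rewrite [X in _ <= X]big_mkcond; apply: leq_sum => w _.
    case: (w \in N u); rewrite ?muln0 //=.
    by case: ltnP => [/ltnW|_]; rewrite ?muln0 // mul1n leq_mul2r orbC => ->.
  rewrite sum_nat_const -mulnn; have := degree_le u.
  by move: #|N u| D => n d nd; rewrite mulnA mulnAC leq_mul2r leq_mul2r nd !orbT.
have h4 : \sum_(s in N u) \sum_(w in N s) #|N w :&: heavy g q s| =
    \sum_(s in N u) heavy_walks g q s.
  apply: eq_bigr => s _; rewrite /heavy_walks.
  transitivity (\sum_(w in N s) \sum_(y in N w) (y \in heavy g q s : nat)).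
    apply: eq_bigr => w _; rewrite -sum1_card big_mkcond [RHS]big_mkcond.
    by apply: eq_bigr => y _; rewrite in_setI; case: (y \in N w).
  rewrite walk_sum [RHS]big_mkcond; apply: eq_bigr => y _.
  by case: (y \in heavy g q s); rewrite ?muln1 ?muln0.
have h5 : \sum_w codeg g u w * q <= D ^ 2 * q.
  rewrite -big_distrl leq_mul2r /=; apply/orP; right.
  have -> : \sum_w codeg g u w = \sum_(s in N u) \sum_(w in N s) 1.
    by rewrite walk_sum; apply: eq_bigr => w _; rewrite muln1.
  apply: leq_trans (_ : \sum_(s in N u) D <= _).
    by apply: leq_sum => s _; rewrite sum1_card.
  by rewrite sum_nat_const -mulnn leq_mul2r degree_le orbT.
rewrite h0 h2 h4; move: h1 h3 h5; rewrite mulnDr muln1 mulnA mulnAC; lia.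
Qed.

(** With this [q], the factor [q - p] in [heavy_walks_le] makes each of the two heavy terms at most
    an eighth of [delta ^ 3], and the lower bound on [delta] makes the last term at most a quarter
    of it. *)
Lemma light_walks_ge : 0 < K -> q = p + 8 * (2 * p + 2) * K ^ 3 ->
  4 * ((1 + 2 * q) * K ^ 2) <= delta -> delta ^ 3 <= 2 * light_walks.
Proof.
move=> K0 qE qdelta; set b := 2 * p + 2 in qE.
have qp0 : q - p = 8 * b * K ^ 3 by rewrite qE addKn.
have lower : delta ^ 3 <= \sum_(s in N u) \sum_(w in N s) #|N w|.
  apply: leq_trans (_ : \sum_(s in N u) \sum_(w in N s) delta <= _); last first.
    by do 2![apply: leq_sum => ? _].
  apply: leq_trans (_ : \sum_(s in N u) delta * delta <= _).
    by rewrite sum_nat_const !expnS expn0 muln1 leq_mul2r degree_ge orbT.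
  by apply: leq_sum => s _; rewrite sum_nat_const leq_mul2r degree_ge orbT.
have hw s : (q - p) * heavy_walks g q s <= b * D ^ 2.
  apply: leq_trans (heavy_walks_le gC gI Lfree s pq) _.
  by rewrite leq_mul2l leq_exp2r ?degree_le ?orbT.
have hwN : (q - p) * (\sum_(s in N u) heavy_walks g q s) <= D * (b * D ^ 2).
  rewrite big_distrr; apply: leq_trans (_ : \sum_(s in N u) b * D ^ 2 <= _).
    by apply: leq_sum => s _; exact: hw.
  by rewrite sum_nat_const leq_mul2r degree_le orbT.
have := leq_trans lower walks_le_light.
set GG := light_walks; set h1 := heavy_walks g q u; set h2 := \sum_(s in N u) _.
move=> main.
have hu : (q - p) * (D * h1) <= D * (b * D ^ 2).
  by rewrite mulnCA leq_mul2l hw orbT.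
have small : 4 * (D ^ 2 * (1 + 2 * q)) <= delta ^ 3.
  apply: leq_trans (_ : delta ^ 2 * (4 * ((1 + 2 * q) * K ^ 2)) <= _).
    by rewrite expnMn; move: (K ^ 2) (delta ^ 2) => ? ?; lia.
  by rewrite [X in _ <= X]expnSr leq_mul2l qdelta orbT.
have big : 4 * (2 * (D * (b * D ^ 2))) = (q - p) * delta ^ 3.
  rewrite qp0 (mulnCA D b) -expnS expnMn; move: (K ^ 3) (delta ^ 3) => ? ?; lia.
have qp : 0 < q - p by rewrite qp0 !muln_gt0 K0 /b addn2.
rewrite -(leq_pmul2l qp) mulnCA.
move: (D ^ 2 * (1 + 2 * q)) (D * (b * D ^ 2)) (D * h1) main small hu hwN big.
rewrite -/h2 => a2 a3 a4 main small hu hwN big.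
have {}main := leq_mul (leqnn (q - p)) main; rewrite 3!mulnDr in main.
have {}small := leq_mul (leqnn (q - p)) small; rewrite mulnCA in small.
move: hu hwN big main small; move: (q - p) (delta ^ 3) => a1 a5.
by move: (a1 * a2) (a1 * a4) (a1 * a5) (a1 * h2) (a1 * GG) => *; lia.
Qed.

(** The best common neighbour does at least as well as the average one. Where [codeg g u w] vanishes
    the value [u] is a dummy. *)
Lemma best_parents : exists par : T -> T, forall w, 0 < codeg g u w ->
  par w \in N u :&: N w /\
  \sum_(s in N u :&: N w) #|Y s w| <= codeg g u w * #|Y (par w) w|.
Proof.
suff /fin_all_exists[par parP] : forall w, exists s, 0 < codeg g u w ->
    s \in N u :&: N w /\ \sum_(s in N u :&: N w) #|Y s w| <= codeg g u w * #|Y s w|.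
  by exists par.
move=> w; case: (posnP (codeg g u w)) => [|/card_gt0P[s0 s0N]]; first by exists u.
case: (arg_maxnP (fun s => #|Y s w|) s0N) => s sN smax; exists s => _; split=> //.
by rewrite -sum_nat_const; apply: leq_sum => t; exact: smax.
Qed.

Let r := q * p.+1 + p.*2 + 2.

Hypothesis p0 : 0 < p.

(** [e] counts the edges, and [W] the left vertices, of the graph [B] joining [w] to [Y (par w) w],
    coloured by [par]. Since [w] has fewer than [q] possible parents, keeping only the best one
    loses at most a factor [q]. *)
Lemma light_walks_le : exists e W : nat,
  [/\ light_walks <= q * e, W <= D ^ 2 &
  e ^ 3 <= 32 * (W * #|T|) * (e * (D * (2 + q + p + q * p)) +
     W * #|T| * ((q * r + 3 * r) * p))].
Proof.
have [par parP] := best_parents.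
pose W : {set T} := [set w in W0 | 0 < codeg g u w].
pose B : rel T := fun w y => (w \in W) && (y \in Y (par w) w).
have BP w y : B w y -> [/\ g u (par w), g (par w) w, g w y, w != u &
    [/\ ~~ g u w, ~~ g u y, codeg g (par w) y < q & w \in W]].
  move=> /andP[wW]; rewrite inE => /andP[wy /andP[cy yN]].
  move: (wW); rewrite 2!inE => /andP[/and3P[wu _ wN] /parP[]].
  rewrite in_setI !in_nbr in wy yN wN * => /andP[? ?] _.
  by split=> //; [rewrite gC | split=> //; move: wW; rewrite 2!inE in_nbr].
exists #|[set e : T * T | B e.1 e.2]|, #|W|; split.
- rewrite /light_walks -sum1_card.
  rewrite (exchange_big_dep (mem W0)) /=; last by move=> s w _ /andP[].
  rewrite (partition_big fst predT) //= big_distrr /=.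
  rewrite [X in X <= _]big_mkcond; apply: leq_sum => w _.
  case: ifP => // wW0; rewrite sum1dep_card.
  have -> : \sum_(i in N u | (w \in N i) && (w \in W0)) #|Y i w| =
      \sum_(s in N u :&: N w) #|Y s w|.
    by apply: eq_bigl => s; rewrite wW0 andbT in_setI !in_nbr (gC s).
  have [c0|c0] := posnP (codeg g u w).
    by move/cards0_eq: c0 => ->; rewrite big_set0.
  have [parN] := parP w c0; move/leq_trans; apply.
  have cq : codeg g u w <= q by move: wW0; rewrite inE => /and3P[_ /ltnW].
  apply: leq_mul => //; apply: (card_le_param (h := snd)) => y yY; exists (w, y) => //.
  by rewrite !in_set /= eqxx /B yY [w \in W]in_set wW0 c0.
- apply: leq_trans (_ : \sum_w codeg g u w * 1 <= _).
    rewrite -sum1_card big_mkcond; apply: leq_sum => w _.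
    by case: ifP => //; rewrite inE muln1 => /andP[].
  rewrite -walk_sum; apply: leq_trans (_ : \sum_(s in N u) D <= _).
    by apply: leq_sum => s _; rewrite sum1_card.
  by rewrite sum_nat_const -mulnn leq_mul2r degree_le orbT.
apply: (coloured_bipartite_bound (c := par)) => //.
- by move=> x; apply/negP => /BP[_ _]; rewrite gI.
- by move=> x y /andP[].
(* The [B]-neighbours of [y] with parent [z] are common neighbours of [z] and [y]; there are none if
   that pair has codegree at least [q]. *)
- move=> y z; case: (ltnP (codeg g z y) q) => zq; last first.
    rewrite (_ : [set x in _ | _] = set0) ?cards0 //; apply/setP => x.
    rewrite !inE; apply/negP => /andP[/BP[_ _ _ _ [_ _ xq _]] /eqP xz].
    by rewrite xz ltnNge zq in xq.
  apply: leq_trans (ltnW zq); apply: subset_leq_card; apply/subsetP => x.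
  rewrite !inE => /andP[/BP[_ px xy _ _] /eqP <-].
  by rewrite px gC.
- move=> y; apply: leq_trans (degree_le y); apply: subset_leq_card.
  by apply/subsetP => x; rewrite !inE gC => /BP[].
- move=> y; apply: leq_trans (degree_le y); apply: subset_leq_card.
  by apply/subsetP => x; rewrite !inE => /BP[].
move=> x y v w Bvw vinj cinj xy cwx vy vw.
pose i0 := Ordinal p0.
(* Distinct colours make [s] injective, and its values lie in [N u], which contains none of [x],
   [y], [v i], [w i]. *)
pose s (o : option 'I_p) := if o is Some i then par (w i) else par x.
have P1 i : B x (v i) by case: (Bvw i).
have P2 i : B (w i) (v i) by case: (Bvw i).
have P3 i : B (w i) y by case: (Bvw i).
have us o : g u (s o).
  case: o => [i|] /=; first by case: (BP _ _ (P3 i)).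
  by case: (BP _ _ (P1 i0)).
have neqN z o : ~~ g u z -> s o != z by apply: contraNneq => <-.
have notN i : ~~ g u (v i) by case: (BP _ _ (P1 i)) => _ _ _ _ [].
have notNw i : ~~ g u (w i) by case: (BP _ _ (P3 i)) => _ _ _ _ [].
have notNx : ~~ g u x by case: (BP _ _ (P1 i0)) => _ _ _ _ [].
have notNy : ~~ g u y by case: (BP _ _ (P3 i0)) => _ _ _ _ [].
have neq_u a b : g a b -> ~~ g u a -> u != b.
  by move=> ab; apply: contraNneq => ->; rewrite gC.
apply: (Lfree (u := u) (x := x) (y := y) (s := s) (v := v) (w := w)); split => //.
- by case: (BP _ _ (P1 i0)).
- by move=> i; case: (BP _ _ (P3 i)).
- by move=> i; case: (BP _ _ (P1 i)).
- by move=> i; rewrite gC; case: (BP _ _ (P2 i)).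
- by move=> i; case: (BP _ _ (P3 i)).
- move=> [i|] [j|] //= => [/cinj->//|/eqP|/eqP]; first by rewrite (negPf (cwx i)).
  by rewrite eq_sym (negPf (cwx j)).
- by move=> i j wij; apply: cinj; rewrite /= wij.
- by rewrite eq_sym; case: (BP _ _ (P1 i0)).
- by apply: (neq_u (w i0)) => //; case: (BP _ _ (P3 i0)).
- by move=> i; apply: (neq_u x) => //; case: (BP _ _ (P1 i)).
- by move=> i; rewrite eq_sym; case: (BP _ _ (P3 i)).
- by move=> o; apply: neqN.
- by move=> o; apply: neqN.
- by move=> o i; apply: neqN.
- by move=> o i; apply: neqN.
- by move=> i; apply: contraNneq (cwx i) => ->.
Qed.

End FixedRoot.
End AlmostRegular.

(** One of the two terms bounding [e ^ 3] is at least half of their sum. If the first,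
    [e ^ 2 = O(m * delta ^ 3)] and [delta ^ 6 = O(e ^ 2)] give [delta ^ 3 = O(m)]; if the second,
    [e ^ 3 = O(m ^ 2 * delta ^ 4)] is compared with [delta ^ 9 = O(e ^ 3)]. *)
Lemma theta_arith q K c1 M m delta e : 0 < delta -> delta ^ 3 <= 2 * (q * e) ->
  e ^ 3 <= 32 * ((K * delta) ^ 2 * m) *
     (e * (K * delta * c1) + (K * delta) ^ 2 * m * M) ->
  delta ^ 5 <= ((256 * q ^ 2 * K ^ 3 * c1) ^ 2 + 512 * q ^ 3 * K ^ 4 * M) * m ^ 2.
Proof.
move=> delta0 low up; have e0 : 0 < e.
  by case: e low {up} => // ; rewrite !muln0 leqn0 expn_eq0; lia.
have low2 : (delta ^ 3) ^ 2 <= 4 * q ^ 2 * e ^ 2.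
  by apply: leq_trans (leq_mul low low) _; apply: eq_leq; rewrite !expnS !expn0; lia.
have low3 : (delta ^ 3) ^ 3 <= 8 * q ^ 3 * e ^ 3.
  apply: leq_trans (leq_mul low (leq_mul low low)) _.
  by apply: eq_leq; rewrite !expnS !expn0; lia.
set s1 := e * _ in up; set s2 := _ * M in up; rewrite mulnDl.
have [s12|s12] := leqP s2 s1.
- set A := 256 * _ * _ * _; suff dA : delta ^ 3 <= A * m.
    apply: leq_trans (leq_addr _ _); rewrite -expnMn.
    apply: leq_trans (_ : (delta ^ 3) ^ 2 <= _); last by rewrite leq_exp2r.
    by rewrite -expnM leq_pexp2l.
  have h : e ^ 3 <= e * (64 * K ^ 3 * c1 * m * delta ^ 3).
    apply: leq_trans up _.
    apply: leq_trans (leq_mul (leqnn _) (leq_add (leqnn s1) s12)) _.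
    by apply: eq_leq; rewrite /s1 !expnS !expn0; lia.
  rewrite expnS leq_pmul2l // in h.
  have d3 : 0 < delta ^ 3 by rewrite expn_gt0 delta0.
  rewrite -(leq_pmul2r d3) mulnn; apply: leq_trans low2 _.
  apply: leq_trans (leq_mul (leqnn _) h) _.
  by apply: eq_leq; rewrite /A !expnS !expn0; lia.
apply: leq_trans (leq_addl _ _).
have h : e ^ 3 <= 64 * K ^ 4 * delta ^ 4 * m ^ 2 * M.
  apply: leq_trans up _.
  apply: leq_trans (leq_mul (leqnn _) (leq_add (ltnW s12) (leqnn s2))) _.
  by apply: eq_leq; rewrite /s2 !expnS !expn0; lia.
have d4 : 0 < delta ^ 4 by rewrite expn_gt0 delta0.
rewrite -(leq_pmul2r d4) -expnD (_ : 5 + 4 = 3 * 3) // expnM; apply: leq_trans low3 _.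
apply: leq_trans (leq_mul (leqnn _) h) _.
by apply: eq_leq; move: (q ^ 3) (K ^ 4) (delta ^ 4) (m ^ 2) => *; lia.
Qed.

Lemma almost_regular_bound p K : 0 < p -> 0 < K -> exists C : nat,
  forall (T : finType) (g : rel T) (delta : nat), symmetric g -> irreflexive g ->
    L_free g p -> 0 < #|T| -> (forall v, delta <= #|nbr g v| <= K * delta) ->
  delta ^ 5 <= C * #|T| ^ 2.
Proof.
move=> p0 K0; pose q := p + 8 * (2 * p + 2) * K ^ 3.
have pq : 3 * p + 4 <= q.
  apply: leq_trans (_ : p + 8 * (2 * p + 2) * 1 <= _); first by clear; lia.
  by rewrite leq_add2l leq_mul2l expn_gt0 K0 orbT.
pose r := q * p.+1 + p.*2 + 2.
pose d0 := 4 * ((1 + 2 * q) * K ^ 2).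
pose C := (256 * q ^ 2 * K ^ 3 * (2 + q + p + q * p)) ^ 2
   + 512 * q ^ 3 * K ^ 4 * ((q * r + 3 * r) * p).
(* The summand [d0 ^ 5] takes care of [delta <= d0]; beyond that [light_walks_ge] applies. *)
exists (C + d0 ^ 5) => T g delta gC gI Lfree T0 deg; rewrite mulnDl.
have [dd|dd] := leqP delta d0.
  apply: leq_trans (leq_addl _ _); apply: leq_trans (_ : d0 ^ 5 <= _).
    by rewrite leq_exp2r.
  by rewrite -[X in X <= _]muln1 leq_mul2l expn_gt0 T0 orbT.
apply: leq_trans (leq_addr _ _).
have [u _] := card_gt0P T0.
have dge v : delta <= #|nbr g v| by case/andP: (deg v).
have dle v : #|nbr g v| <= K * delta by case/andP: (deg v).
have low := light_walks_ge gC gI Lfree dge dle u pq K0 erefl (ltnW dd).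
have [e [W [Le WD up]]] := light_walks_le gC gI Lfree dle q u p0.
apply: (@theta_arith q K _ _ _ _ e).
- by apply: leq_ltn_trans dd.
- by apply: leq_trans low _; rewrite leq_mul2l Le.
apply: leq_trans up _; apply: leq_mul.
  by rewrite leq_mul2l leq_mul2r WD orbT.
by rewrite leq_add2l !leq_mul // leq_mul2r WD orbT.
Qed.

Lemma L_copy_map (T T' : finType) (f : T' -> T) (g : rel T) p u x y s v w :
  injective f -> @L_copy T' (fun a b => g (f a) (f b)) p u x y s v w ->
  L_copy g (f u) (f x) (f y) (f \o s) (f \o v) (f \o w).
Proof.
move=> finj [*]; split=> //=; do ?[exact: inj_comp]; move=> *; by rewrite inj_eq.
Qed.

(** * Reduction to almost regular graphs *)

Section Regularise.
Variables (T : finType) (g : rel T).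
Hypotheses (gC : symmetric g) (gI : irreflexive g).
Local Notation N := (nbr g).

(** Twice the number of edges inside [S]. *)
Definition darts (S : {set T}) := \sum_(v in S) #|N v :&: S|.

Lemma sum_nbr_swap (A B : {set T}) :
  \sum_(v in A) #|N v :&: B| = \sum_(v in B) #|N v :&: A|.
Proof.
transitivity (\sum_(v in A) \sum_(w in B) (g v w : nat)).
  apply: eq_bigr => v _; rewrite -sum1_card big_mkcond [RHS]big_mkcond.
  by apply: eq_bigr => w _; rewrite in_setI in_nbr; case: (g v w); case: (w \in B).
rewrite exchange_big; apply: eq_bigr => v _.
rewrite -sum1_card big_mkcond [RHS]big_mkcond.
by apply: eq_bigr => w _; rewrite in_setI in_nbr gC; case: (g v w); case: (w \in A).
Qed.

Lemma darts_setD_ge (S F : {set T}) : F \subset S ->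
  darts S <= darts (S :\: F) + 2 * \sum_(v in F) #|N v :&: S|.
Proof.
move=> FS; rewrite {1}/darts (big_setID F) /= (setIidPr FS).
rewrite mul2n -addnn addnA addnC leq_add2r.
rewrite [X in _ <= _ + X]sum_nbr_swap [X in _ <= _ + X](big_setID F) /= (setIidPr FS).
rewrite addnCA; apply: leq_trans (leq_addl _ _).
rewrite -big_split; apply: leq_sum => v _ /=.
rewrite -(cardsID F (N v :&: S)) addnC -setIDA leq_add2l.
by apply: subset_leq_card; apply: setSI; exact: subsetIl.
Qed.

Lemma darts_le_sqr (S : {set T}) : darts S <= #|S| ^ 2.
Proof.
rewrite -mulnn -sum_nat_const; apply: leq_sum => v _.
by rewrite subset_leq_card // subsetIr.
Qed.

(** Removing a vertex of least [f] does not lower the average of [f]; this is repeated down to [k]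
    vertices. *)
Lemma exists_rich_subset (f : T -> nat) (S : {set T}) k : k <= #|S| ->
  exists U : {set T}, [/\ U \subset S, #|U| = k &
    k * (\sum_(v in S) f v) <= #|S| * \sum_(v in U) f v].
Proof.
move En : (#|S| - k) => n; elim: n S En => [|n IH] S En kS.
  by exists S; split=> //; [lia | rewrite (_ : #|S| = k) //; lia].
have /card_gt0P[v0 v0S] : 0 < #|S| by lia.
case: (arg_minnP f v0S) => v vS0 vmin.
have vS : v \in S by [].
have cS : #|S| = #|S :\ v|.+1 by rewrite (cardsD1 v S) vS.
have [||U [US Uk Uf]] := IH (S :\ v); [lia | lia |].
exists U; split=> //; first exact: subset_trans US (subD1set _ _).
have sum_ge : #|S :\ v| * f v <= \sum_(w in S :\ v) f w.
  by rewrite -sum_nat_const; apply: leq_sum => w /setD1P[_ /vmin].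
rewrite (big_setD1 v) //=.
have [s0|s0] := posnP #|S :\ v|.
  have -> : k = 0 by lia.
  by [].
rewrite -(leq_pmul2l s0) cS; move: sum_ge Uf s0.
move: #|S :\ v| (\sum_(w in S :\ v) f w) (\sum_(w in U) f w) (f v) => a b c d.
move=> h1 h2 h3.
have h4 : k * (a * d) <= k * b by rewrite leq_mul2l h1 orbT.
have h5 : a.+1 * (k * b) <= a.+1 * (a * c) by rewrite leq_mul2l h2.
lia.
Qed.

(** [U] is a smallest set with [E * (m + #|U|) <= 4 * m * darts U]: [S] satisfies this, the empty
    set does not, and deleting a vertex of degree below [E / (8 * m)] would preserve it. *)
Lemma exists_min_degree_subset (S : {set T}) m E :
    0 < E -> 0 < m -> #|S| <= m -> E <= 2 * darts S ->
  exists U : {set T}, [/\ U \subset S, 0 < #|U| &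
    forall v, v \in U -> E <= 8 * m * #|N v :&: U|].
Proof.
move=> E0 m0 Sm SE.
pose P := [pred U : {set T} | (U \subset S) && (E * (m + #|U|) <= 4 * m * darts U)].
have PS : P S.
  rewrite /= subxx /=; apply: leq_trans (_ : E * (m + m) <= _).
    by rewrite leq_mul2l leq_add2l Sm orbT.
  by nia.
case: (arg_minnP (fun U : {set T} => #|U|) PS) => U /andP[US UE] Umin.
exists U; split=> // [|v vU].
  rewrite card_gt0; apply: contraTneq UE => ->.
  by rewrite /darts big_set0 cards0 addn0 muln0 -ltnNge muln_gt0 E0.
rewrite leqNgt; apply/negP => small.
have : P (U :\ v).
  rewrite /= (subset_trans (subD1set _ _) US) /=.
  have := @darts_setD_ge U [set v]; rewrite sub1set big_set1 => /(_ vU) h.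
  move: UE; rewrite (cardsD1 v U) vU.
  move: (darts U) (darts (U :\ v)) #|N v :&: U| #|U :\ v| h small => a b c d h small UE.
  have h' : 4 * m * a <= 4 * m * (b + 2 * c) by rewrite leq_mul2l h orbT.
  lia.
by move/Umin; rewrite (cardsD1 v U) vU; lia.
Qed.

Section Step.
Variables (p R C C' : nat).
Hypothesis R_ge : 2 ^ 9 * 4 ^ 5 <= R ^ 2.
Hypothesis R4 : 4 < R.
Hypothesis Lfree : L_free g p.
Hypothesis regC : forall (T : finType) (g : rel T) (delta : nat),
    symmetric g -> irreflexive g -> L_free g p -> 0 < #|T| -> (forall v, delta <= #|nbr g v| <= (16 * R) * delta) ->
  delta ^ 5 <= C * #|T| ^ 2.
Hypothesis C'_R : R ^ 3 <= C'.
Hypothesis C'_C : 16 ^ 5 * C <= C'.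
Hypothesis C'_8 : 8 ^ 5 <= C'.

(** [regC] is applied to the induced subgraph, whose vertex type is the subtype of [U]. *)
Lemma induced_bound (U : {set T}) delta : 0 < #|U| ->
    (forall v, v \in U -> delta <= #|N v :&: U| <= (16 * R) * delta) ->
  delta ^ 5 <= C * #|U| ^ 2.
Proof.
move=> U0 deg.
have cardU : #|{: {x | x \in U}}| = #|U| by rewrite card_sig.
rewrite -cardU; apply: (regC (g := fun a b => g (val a) (val b))).
- by move=> a b; exact: gC.
- by move=> a; exact: gI.
- move=> u x y s v w /(L_copy_map (f := val) (g := g) val_inj).
  exact: Lfree.
- by rewrite cardU.
move=> v; suff -> : #|nbr (fun a b : {x | x \in U} => g (val a) (val b)) v| =
    #|N (val v) :&: U| by exact/deg/valP.
rewrite -(card_imset _ val_inj); apply: eq_card => w; rewrite in_setI.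
apply/imsetP/andP => [[a]|[]].
  by rewrite !inE => va ->; split; [| exact: valP].
by rewrite inE => vw wU; exists (Sub w wU); rewrite ?inE ?SubK.
Qed.

Lemma darts_bound (S : {set T}) : darts S ^ 5 <= C' * #|S| ^ 7.
Proof.
move Em : #|S| => m; elim/ltn_ind: m => m IH in S Em *.
rewrite leqNgt; apply/negP; set E := darts S => big.
have m0 : 0 < m.
  rewrite lt0n; apply: contraTneq big => m0; move: Em; rewrite m0 => /cards0_eq S0.
  by rewrite /E S0 /darts big_set0.
have E0 : 0 < E by case: (posnP E) big => // ->.
(* [E <= m ^ 2] turns the violated bound into [C' < m ^ 3]. *)
have mR : R <= m.
  have : C' * m ^ 7 < m ^ 3 * m ^ 7.
    apply: leq_trans big _; rewrite -expnD (_ : 3 + 7 = 2 * 5) // expnM.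
    by rewrite leq_exp2r // -Em darts_le_sqr.
  rewrite ltn_mul2r => /andP[_ /(leq_ltn_trans C'_R)].
  by rewrite ltn_exp2r // => /ltnW.
have E8 : 8 * m <= E.
  rewrite -(leq_exp2r _ _ (isT : 0 < 5)); apply: leq_trans (ltnW big).
  rewrite expnMn; apply: leq_mul => //.
  by rewrite leq_pexp2l.
(* [k] is about [m / R]; it bounds the number of vertices of degree above [R] times the average
   [E / m], which form [F]. *)
pose k := (m %/ R).+1.
have Rk : R * k <= 2 * m by have := leq_divM m R; rewrite /k; lia.
have mk : m <= R * k by have := ltn_ceil m (_ : 0 < R); rewrite /k; lia.
pose F := [set v in S | R * E < #|N v :&: S| * m].
have FS : F \subset S by apply/subsetP => v; rewrite inE => /andP[].
set sigma := \sum_(v in F) #|N v :&: S|.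
have Fk : #|F| <= k.
  have : #|F| * (R * E) <= E * m.
    apply: leq_trans (_ : sigma * m <= _); last first.
      rewrite leq_mul2r /E /darts (big_setID F) /= (setIidPr FS).
      by rewrite leq_addr orbT.
    rewrite -sum_nat_const /sigma big_distrl.
    by apply: leq_sum => v; rewrite inE => /andP[_ /ltnW].
  rewrite mulnA (mulnC E) leq_pmul2r // => FR.
  have : #|F| <= m %/ R by rewrite leq_divRL //; lia.
  by rewrite /k; lia.
have km : k <= #|S| by rewrite Em; nia.
(* Adding to [F] a set of [k] vertices rich in neighbours in [F] gives at most [2 * k < m] vertices,
   to which induction applies, carrying at least a share [k / m] of [sigma]. *)
have [U [US Uk Uf]] := exists_rich_subset (fun v => #|N v :&: F|) km.
rewrite -sum_nbr_swap -/sigma Em in Uf.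
have sigma_le : k * sigma <= m * darts (F :|: U).
  apply: leq_trans Uf _; rewrite leq_mul2l; apply/orP; right.
  apply: leq_trans (_ : \sum_(v in U) #|N v :&: (F :|: U)| <= _).
    by apply: leq_sum => v _; rewrite subset_leq_card // setIS // subsetUl.
  by rewrite /darts [X in _ <= X](big_setID U) /= (setIidPr (subsetUr F U)) leq_addr.
have FU : #|F :|: U| <= 2 * k by rewrite cardsU; lia.
have FUm : #|F :|: U| < m by apply: leq_ltn_trans FU _; nia.
(* Induction gives [sigma ^ 5 <= 2 ^ 7 * C' * m ^ 5 * k ^ 2], and [k <= 2 * m / R] brings this to at
   most [2 ^ 9 * E ^ 5 / R ^ 2]. *)
have sigma5 : 4 * sigma <= E.
  have k5 : 0 < k ^ 5 by rewrite expn_gt0.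
  have h1 : k ^ 5 * sigma ^ 5 <= k ^ 5 * (2 ^ 7 * C' * m ^ 5 * k ^ 2).
    rewrite -expnMn; apply: leq_trans (_ : (m * darts (F :|: U)) ^ 5 <= _).
      by rewrite leq_exp2r.
    rewrite expnMn; apply: leq_trans (_ : m ^ 5 * (C' * (2 * k) ^ 7) <= _).
      rewrite leq_mul2l; apply/orP; right; apply: leq_trans (IH _ FUm _ erefl) _.
      by rewrite leq_mul2l leq_exp2r // FU orbT.
    rewrite expnMn (expnD k 2 5 : k ^ 7 = _).
    by apply: eq_leq; move: (m ^ 5) (2 ^ 7) (k ^ 2) (k ^ 5) => *; lia.
  rewrite leq_pmul2l // in h1.
  have h2 : R ^ 2 * sigma ^ 5 <= 2 ^ 9 * E ^ 5.
    apply: leq_trans (leq_mul (leqnn _) h1) _.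
    apply: leq_trans (_ : 2 ^ 7 * C' * m ^ 5 * (2 * m) ^ 2 <= _).
      have : (R * k) ^ 2 <= (2 * m) ^ 2 by rewrite leq_exp2r.
      rewrite expnMn; move: (2 ^ 7) (m ^ 5) (k ^ 2) (R ^ 2) ((2 * m) ^ 2) => a b c d f h.
      by rewrite mulnC -mulnA leq_mul2l (mulnC c) h orbT.
    apply: leq_trans (_ : 2 ^ 9 * (C' * m ^ 7) <= _); last first.
      by rewrite leq_mul2l (ltnW big) orbT.
    rewrite expnMn (expnD 2 7 2 : 2 ^ 9 = _) (expnD m 5 2 : m ^ 7 = _).
    by apply: eq_leq; move: (2 ^ 7) (2 ^ 2) (m ^ 5) (m ^ 2) => *; lia.
  rewrite -(leq_exp2r _ _ (isT : 0 < 5)) -(leq_pmul2l (expn_gt0 2 9 : 0 < 2 ^ 9)).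
  apply: leq_trans h2; rewrite expnMn mulnA leq_mul2r; apply/orP; right.
  exact: R_ge.
have SE : E <= 2 * darts (S :\: F).
  by have := darts_setD_ge FS; rewrite -/E -/sigma; lia.
have SFm : #|S :\: F| <= m by rewrite -Em subset_leq_card // subsetDl.
have [V [VS V0 Vd]] := exists_min_degree_subset E0 m0 SFm SE.
(* By [E8] the quotient is positive, so rounding down costs at most a factor 2. Degrees in [V] then
   lie between [delta] and [R * E / m <= 16 * R * delta], the ratio in [regC]. *)
pose delta := E %/ (8 * m).
have m8 : 0 < 8 * m by rewrite muln_gt0.
have delta0 : 0 < delta by rewrite divn_gt0.
have Edelta : E <= 16 * m * delta.
  apply: leq_trans (ltnW (ltn_ceil E m8)) _; rewrite -/delta.
  by rewrite mulnC (_ : 16 * m = 8 * m * 2) -?mulnA ?leq_mul2l; lia.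
have deltaC : delta ^ 5 <= C * #|V| ^ 2.
  apply: induced_bound => // v vV; apply/andP; split.
    by rewrite -[X in _ <= X](mulKn _ m8) leq_div2r // Vd.
  have : v \in S :\: F by apply: (subsetP VS).
  rewrite !inE => /andP[vF vS]; rewrite vS /= -leqNgt in vF.
  rewrite -(leq_pmul2r m0); apply: leq_trans (_ : #|N v :&: S| * m <= _).
    rewrite leq_mul2r subset_leq_card ?orbT // setIS //.
    by apply: subset_trans VS _; exact: subsetDl.
  apply: leq_trans vF _; apply: leq_trans (leq_mul (leqnn R) Edelta) _.
  by apply: eq_leq; clear; lia.
move: big; rewrite ltnNge => /negP; apply.
apply: leq_trans (_ : (16 * m * delta) ^ 5 <= _); first by rewrite leq_exp2r.
rewrite !expnMn (expnD m 5 2 : m ^ 7 = _).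
apply: leq_trans (_ : 16 ^ 5 * m ^ 5 * (C * m ^ 2) <= _).
  rewrite leq_mul2l; apply/orP; right; apply: leq_trans deltaC _.
  rewrite leq_mul2l leq_exp2r // -Em subset_leq_card ?orbT //.
  by apply: subset_trans VS _; exact: subsetDl.
have := leq_mul C'_C (leqnn (m ^ 5 * m ^ 2)).
by move: (16 ^ 5) (m ^ 5) (m ^ 2) => *; lia.
Qed.
End Step.
End Regularise.

Lemma L_free_darts_bound p : 0 < p -> exists C : nat,
  forall (T : finType) (g : rel T), symmetric g -> irreflexive g -> L_free g p ->
  darts g [set: T] ^ 5 <= C * #|T| ^ 7.
Proof.
(* This value meets [2 ^ 9 * 4 ^ 5 = 2 ^ 19 <= R ^ 2 = 2 ^ 20]. *)
move=> p0; have [R RE] : exists R, R = 2 ^ 10 by exists (2 ^ 10).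
have R_ge : 2 ^ 9 * 4 ^ 5 <= R ^ 2.
  by rewrite RE -(expnM 2 2 5) -expnD -expnM leq_exp2l.
have R4 : 4 < R by rewrite RE (_ : 4 = 2 ^ 2) // ltn_exp2l.
have [|C regC] := @almost_regular_bound p (16 * R) p0.
  by rewrite muln_gt0 (leq_trans _ R4).
(* In [darts_bound] the summands yield in turn [R <= m], the final contradiction, and
   [delta > 0]. *)
exists (R ^ 3 + 16 ^ 5 * C + 8 ^ 5) => T g gC gI Lfree; rewrite -cardsT.
apply: (darts_bound (R := R) (C := C) gC gI R_ge R4 Lfree regC).
- by rewrite -addnA leq_addr.
- by rewrite addnAC leq_addl.
- exact: leq_addl.
Qed.

(** * From copies to subgraphs *)

Section Embedding.
Variables (V : finType) (G : graph V) (p : nat).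

Definition adj : rel V := fun a b => [set a; b] \in edges G.

Lemma adjC : symmetric adj.
Proof. by move=> a b; rewrite /adj setUC. Qed.

Lemma adjI : irreflexive adj.
Proof.
move=> a; apply/negP => /(forall_inP (edges_card2 G)).
by rewrite setUid cards1.
Qed.

Lemma card_edges_le_darts : #|edges G| <= darts adj [set: V].
Proof.
rewrite /darts; under eq_bigr => v _ do rewrite setIT -sum1_card.
rewrite pair_big_dep /= sum1dep_card.
apply: (card_le_param (h := fun a : V * V => [set a.1; a.2])) => e eG.
have /cards2P[a [b [ab eE]]] := forall_inP (edges_card2 G) e eG.
by exists (a, b) => //; rewrite !inE /= /adj -eE.
Qed.

Lemma contains_L_of_copy u x y s v w : @L_copy V adj p u x y s v w ->
  contains G (L 3 (theta3 p)).
Proof.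
case=> us sx sw xv vw wy sI vI wI ux uy uv uw xy nsx nsy nsv nsw nxw nvy nvw.
(* [sub] indexes part A by [option 'I_p], the end [false] being [None]; it is injective on part A
   only. *)
pose sub (a : theta3_vertex p) : option 'I_p :=
  if a is inr (i, _) then Some i else None.
pose f (z : L_vertex 3 (theta3 p)) : V :=
  match z with
  | inl (inl false) => x
  | inl (inl true) => y
  | inl (inr (i, false)) => v i
  | inl (inr (i, true)) => w i
  | inr None => u
  | inr (Some (a, _)) => s (sub (val a))
  end.
have subI (a b : {a : theta3_vertex p | a \in partA (theta3 p)}) :
    sub (val a) = sub (val b) -> a = b.
  case: a b => [a aA] [b bA] /= ab; apply: val_inj => /=.
  have inA c : c \in theta3_partA p ->
      c = if sub c is Some i then theta3_inner i true else theta3_end p false.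
    by rewrite !inE => /orP[/eqP->|/imsetP[i _ ->]].
  by rewrite (inA a aA) (inA b bA) ab.
have xv_neq i : x != v i.
  by apply: contraTneq (xv i) => <-; rewrite adjI.
have yw_neq i : w i != y.
  by apply: contraTneq (wy i) => ->; rewrite adjI.
have us_neq o : u != s o.
  by apply: contraTneq (us o) => <-; rewrite adjI.
have finj : injective f.
  have neqs := (xy, ux, uy, uv, uw, nsx, nsy, nsv, nsw, nxw, nvy, nvw,
                xv_neq, yw_neq, us_neq).
  move=> [[[]|[i []]]|[[a j]|]] [[[]|[i' []]]|[[a' j']|]] //= H;
    do ?[by rewrite (vI _ _ H) | by rewrite (wI _ _ H)
        | by rewrite (subI _ _ (sI _ _ H)) (ord1 j) (ord1 j')];
    by exfalso; move/eqP: H; apply/negP; rewrite ?neqs // eq_sym neqs.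
apply/existsP; exists (finfun f); apply/andP; split.
  by apply/injectiveP => a b; rewrite !ffunE => /finj.
have imE a b : [ffun z => f z] @: [set a; b] = [set f a; f b].
  by rewrite imsetU1 imset_set1 !ffunE.
apply/forall_inP => e; rewrite inE => /orP[/imsetP[e' e'H ->]|].
  rewrite -imset_comp; move: e'H => /bigcupP[i _].
  rewrite !inE => /orP[/orP[]|] /eqP->; rewrite imsetU1 imset_set1 /= !ffunE /=.
  - exact: xv.
  - exact: vw.
  - exact: wy.
move=> /bigcupP[a _ /imsetP[[k kt] _ ->]]; rewrite imE.
have edgeE (z z' : V) : adj z z' -> [set z; z'] \in edges G by [].
apply: edgeE.
(* With [t = 3] each path has two edges: from [u] to a vertex [s o], then from there to the vertex
   of part A. *)
case: k kt => [|[|k]] kt //=.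
  case: insubP => [j _ _|//] /=; exact: us.
case: insubP => [j _ _|//]; case: insubP => [j' j'lt _|_ /=]; first by [].
case: a => a aA /=; rewrite !inE in aA.
by case/orP: aA => [/eqP->|/imsetP[i _ ->]]; [exact: sx | exact: sw].
Qed.

End Embedding.

(** * Extremal numbers: the bound in fifth powers, then with the real exponent 7/5 *)

Lemma ex_pow5_bound p : 0 < p -> exists C : nat,
  forall n, ex n (L 3 (theta3 p)) ^ 5 <= C * n ^ 7.
Proof.
move=> p0; have [C CP] := L_free_darts_bound p0; exists C => n.
rewrite /ex; apply: (big_ind (fun k => k ^ 5 <= C * n ^ 7)) => //.
  by move=> a b ha hb; rewrite /maxn; case: ifP.
move=> G /negP noL; apply: leq_trans (_ : darts (adj G) [set: 'I_n] ^ 5 <= _).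
  by rewrite leq_exp2r // card_edges_le_darts.
rewrite -[X in X ^ 7](card_ord n); apply: CP.
- exact: adjC.
- exact: adjI.
by move=> u x y s v w /contains_L_of_copy.
Qed.

Import Order.TTheory GRing.Theory Num.Theory.
Local Open Scope ring_scope.

Theorem theorem5p2 (R : realType) (p : nat) (hp : (2 <= p)%N) :
  exists2 c : R, 0 < c &
    forall n : nat, (ex n (L 3 (theta3 p)))%:R <= c * n%:R `^ (7 / 5).
Proof.
(* [C.+1] replaces a fifth root of [C]: it is positive and its fifth power is at least [C]. *)
have [C CP] := ex_pow5_bound (ltnW hp); exists C.+1%:R => [|n]; first by rewrite ltr0n.
rewrite -(@ler_pXn2r _ 5) ?nnegrE ?mulr_ge0 ?ler0n ?powR_ge0 // exprMn.
have -> : ((n%:R : R) `^ (7 / 5)) ^+ 5 = n%:R ^+ 7.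
  rewrite -(powR_mulrn 5 (powR_ge0 _ _)) -powRrM -(powR_mulrn 7 (ler0n R n)).
  by congr (_ `^ _); rewrite divfK ?pnatr_eq0.
rewrite -!natrX -natrM ler_nat; apply: leq_trans (CP n) _.
rewrite leq_mul2r; apply/orP; right; apply: leq_trans (leqnSn C) _.
by rewrite -[X in (X <= _)%N]expn1 leq_pexp2l.
Qed.
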